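(* Let $\alpha\in(0,1)$, $B\in\mathbb{N}$, $\lambda=(\lambda_1,\lambda_2)\in(0,\infty)^2$. The permutation test $\Delta_\alpha^{\lambda,B}$ (defined in the context) has non-asymptotic level $\alpha$: for every probability distribution $P\in\mathcal{P}$, if $X_1,\dots,X_n,Y_1,\dots,Y_m$ are i.i.d. with distribution $P$ and $\mathbb{Z}_B$ is the independent tuple of $B$ i.i.d. uniform permutations used by the test, then $$\mathbb{P}_{P\times P\times r}\left(\Delta_\alpha^{\lambda,B}(\mathbb{X}_n,\mathbb{Y}_m,\mathbb{Z}_B)=1\right)\le\alpha .$$
   Context: **Diagrams and intensities.** $\Omega=\{(x,y)\in\mathbb{R}^2: y>x\ge 0\}$ and, for $M>0$, $\Omega(M)=\{(x,y)\in\Omega:y<M\}$. $\mathbf{PD}$ is the set of locally finite integer-valued (counting) measures on $\Omega$, i.e. persistence diagrams, identified with multisets $D=\sum_{\mathbf{x}\in D}\delta_{\mathbf{x}}$; it carries the $\sigma$-field generated by the maps $D\mapsto D(A)$, $A\subset\Omega$ relatively compact Borel. $|D|$ is the number of points of $D$ with multiplicity. For a random $D$, $\mathbb{E}(D)$ is the measure $A\mapsto\mathbb{E}(D(A))$; if it has a density $p$ with respect to Lebesgue measure $\mathrm{Leb}_2$, $p$ is the persistence intensity function, and if $D\sim P$ one writes $\mathbb{E}(P)=p$. For a filtration $\mathcal{K}(\mathcal{X})=\{\mathcal{K}(\mathcal{X},r)\}_{r>0}$ (increasing family of simplicial complexes built on a point cloud $\mathcal{X}$), $\mathrm{PD}_k(\mathcal{K}(\mathcal{X}))$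 is the multiset of (birth, death) pairs in $\Omega$ of its $k$-dimensional persistent homology; the map $\mathcal{X}\mapsto \mathrm{PD}_k(\mathcal{K}(\mathcal{X}))$ is assumed measurable. **Weight.** $w:\Omega(M)\to(0,\infty)$ is smooth, nondecreasing in $y-x$, with $\|w^2\|_\infty<\infty$; it admits a compactly supported smooth extension to $\mathbb{R}^2$, still denoted $w$. **Kernel.** For $i=1,2$, $k^i:\mathbb{R}\to[0,\infty)$ is a positive definite function in $L^1(\mathbb{R})\cap L^2(\mathbb{R})$ with $k^i(x)=k^i(-x)$ and $\int k^i=1$. For $\lambda\in(0,\infty)^2$, $\varphi_\lambda(u)=\prod_{i=1}^2\lambda_i^{-1}k^i(u_i/\lambda_i)$ and $k_\lambda(x,y)=\varphi_\lambda(x-y)$. **Class $\mathcal{P}=\mathcal{P}(M,N)$** ($M,N>0$ fixed): all distributions $P$ on $\mathbf{PD}$ such that $D\sim P$ satisfies: (i) $D=\mathrm{PD}_k(\mathcal{K}(\mathcal{X}))$ for some $k\ge0$, some filtration $\mathcal{K}$ and some random point cloud $\mathcal{X}$; (ii) every $(x,y)\in D$ has $y<M$; (iii) there are a discrete random variable $Z$ with values in $\mathbb{N}$ and a function $h:\mathbb{N}\to\mathbb{R}$ such that, conditionally on $Z=\ell$, $|D|\le h(\ell)$; for each $\ell$ the density $p_\ell=d\mathbb{E}[D\mid Z=\ell]/d\mathrm{Leb}_2$ exists; and $\sum_{\ell\ge1}h(\ell)\|w^2 p_\ell\|_\infty\mathbb{P}(Z=\ell)\le N$. **Statistic and test.**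 $n,m\ge2$; $\mathbb{X}_n=(X_1,\dots,X_n)$, $\mathbb{Y}_m=(Y_1,\dots,Y_m)$ are independent samples of diagrams. $K_\lambda(X,Y)=\sum_{\mathbf{z}\in X}\sum_{\mathbf{z}'\in Y}w(\mathbf{z})w(\mathbf{z}')k_\lambda(\mathbf{z},\mathbf{z}')$, $h_\lambda(X,X',Y,Y')=K_\lambda(X,X')+K_\lambda(Y,Y')-K_\lambda(X,Y')-K_\lambda(X',Y)$, and $$\widehat T_\lambda(\mathbb{X}_n,\mathbb{Y}_m)=\frac{1}{n(n-1)m(m-1)}\sum_{1\le i\ne i'\le n}\sum_{1\le j\ne j'\le m}h_\lambda(X_i,X_{i'},Y_j,Y_{j'}).$$ Let $U_i=X_i$ ($i\le n$), $U_{n+j}=Y_j$ ($j\le m$). For a permutation $\sigma$ of $\{1,\dots,n+m\}$, $\widehat T_\lambda^\sigma=\widehat T_\lambda((U_{\sigma(i)})_{i\le n},(U_{\sigma(n+j)})_{j\le m})$. Let $\mathbb{Z}_B=(\sigma^{(1)},\dots,\sigma^{(B)})$ be i.i.d. uniform permutations independent of the data ($r$ denotes their law), $\widehat T^b=\widehat T_\lambda^{\sigma^{(b)}}$ for $b\le B$ and $\widehat T^{B+1}=\widehat T_\lambda(\mathbb{X}_n,\mathbb{Y}_m)$. Set $\widehat q^{B}_{1-\alpha}(\mathbb{Z}_B|\mathbb{X}_n,\mathbb{Y}_m)=\inf\{u\in\mathbb{R}:1-\alpha\le\frac{1}{B+1}\sum_{b=1}^{B+1}\mathbf{1}(\widehat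 T^b\le u)\}$ and $\Delta_\alpha^{\lambda,B}(\mathbb{X}_n,\mathbb{Y}_m,\mathbb{Z}_B)=\mathbf{1}(\widehat T_\lambda(\mathbb{X}_n,\mathbb{Y}_m)>\widehat q^{B}_{1-\alpha}(\mathbb{Z}_B|\mathbb{X}_n,\mathbb{Y}_m))$. *)

(* Defs.v *)
From HB Require Import structures.
From mathcomp Require Import all_boot all_order all_algebra all_fingroup finmap.
From mathcomp Require Import all_classical all_reals all_analysis.
From mathcomp Require Import measurable_realfun.

Set Implicit Arguments.
Unset Strict Implicit.
Unset Printing Implicit Defensive.

Import Order.TTheory GRing.Theory Num.Theory.
Import numFieldNormedType.Exports.

Local Open Scope classical_set_scope.
Local Open Scope ring_scope.

Definition Omega (R : realType) : set (R * R) :=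
  [set z | z.1 < z.2 /\ 0 <= z.1].
Arguments Omega {R}.

Definition OmegaM (R : realType) (M : R) : set (R * R) :=
  Omega `&` [set z | z.2 < M].

Definition relatively_compact_in_Omega (R : realType) (A : set (R * R)) :=
  compact (closure A) /\ closure A `<=` Omega.

(* A locally finite counting measure on Omega, given by the multiset of its
   atoms; [diagram_mult D z] is the multiplicity of [z]. *)
Record diagram (R : realType) := Diagram {
  diagram_mult :> R * R -> nat;
  diagram_support : forall z, diagram_mult z != 0%N -> Omega z;
  diagram_locally_finite : forall A, relatively_compact_in_Omega A ->
    finite_set (A `&` [set z | diagram_mult z != 0%N])
}.

Section empty_diagram.
Variable R : realType.

Lemma empty_diagram_support (z : R * R) :
  (fun=> 0%N) z != 0%N -> Omega z.
Proof. by []. Qed.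

Lemma empty_diagram_locally_finite (A : set (R * R)) :
  relatively_compact_in_Omega A ->
  finite_set (A `&` [set z | (fun=> 0%N) z != 0%N]).
Proof.
move=> _; rewrite (_ : _ `&` _ = set0) //.
by apply/seteqP; split => // z [].
Qed.

Definition empty_diagram : diagram R :=
  Diagram empty_diagram_support empty_diagram_locally_finite.

End empty_diagram.

HB.instance Definition _ (R : realType) := gen_eqMixin (diagram R).
HB.instance Definition _ (R : realType) := gen_choiceMixin (diagram R).
HB.instance Definition _ (R : realType) :=
  isPointed.Build (diagram R) (empty_diagram R).

Definition diagram_count (R : realType) (D : diagram R) (A : set (R * R))
    : \bar R :=
  \esum_(z in A) ((D z)%:R : R)%:E.

Definition diagram_generators (R : realType) : set (set (diagram R)) :=
  [set G | exists (A : set (R * R)) (B : set (\bar R)),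
    [/\ measurable A, relatively_compact_in_Omega A, measurable B &
        G = (fun D => diagram_count D A) @^-1` B]].

Notation PD R := (g_sigma_algebraType (@diagram_generators R)).

Section homology.
Variables (F : fieldType) (V : finType).

Definition is_complex (C : {set {set V}}) : Prop :=
  finset.set0 \notin C /\
  forall s t : {set V}, s \in C -> t \subset s -> t != finset.set0 -> t \in C.

(* Chains of all degrees on the full simplex on V; a simplex is oriented by the
   enumeration order of V. *)
Definition chain := {ffun {set V} -> F^o}.

(* The coefficient of the boundary of c at t: the vertex v has position
   #{u in t | u < v} in the simplex v |: t.  No augmentation: vertices have zero
   boundary. *)
Definition boundary_fun (c : chain) : chain :=
  [ffun t : {set V} => if t == finset.set0 then 0 else
     \sum_(v | v \notin t)
       (-1) ^+ #|[pred u in t | (enum_rank u < enum_rank v)%N]| * c (v |: t)%SET].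

Lemma boundary_fun_is_linear : linear boundary_fun.
Proof.
move=> a c1 c2; apply/ffunP => t; rewrite !ffunE; case: ifP => _.
  by rewrite scaler0 addr0.
rewrite scaler_sumr -big_split; apply: eq_bigr => v _ /=.
by rewrite !ffunE mulrDr; congr (_ + _); rewrite mulrCA.
Qed.

HB.instance Definition _ := GRing.isLinear.Build F chain chain _ boundary_fun
  boundary_fun_is_linear.

Definition boundary : 'End(chain) := linfun boundary_fun.

Definition simplex_chain (s : {set V}) : chain :=
  [ffun t => (t == s)%:R].

Definition chains (k : nat) (C : {set {set V}}) : {vspace chain} :=
  (\sum_(s in C | #|s| == k.+1) <[simplex_chain s]>)%VS.

Definition cycles k C : {vspace chain} := (chains k C :&: lker boundary)%VS.

Definition boundaries k C : {vspace chain} := (boundary @: chains k.+1 C)%VS.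

(* The rank of H_k(C) -> H_k(C') for C contained in C', that is, the dimension of
   its image Z_k(C) / (Z_k(C) `&` B_k(C')). *)
Definition persistent_rank k (C C' : {set {set V}}) : nat :=
  (\dim (cycles k C) - \dim (cycles k C :&: boundaries k C')%VS)%N.

End homology.

Section persistence.
Variables (R : realType) (F : fieldType) (V : finType).

(* Filtrations are indexed by r > 0; values of K at r <= 0 are irrelevant. *)
Definition is_filtration (K : R -> {set {set V}}) : Prop :=
  (forall r, 0 < r -> is_complex (K r)) /\
  (forall r s, 0 < r -> r <= s -> K r \subset K s).

(* Persistent Betti numbers; the complex at a parameter s <= 0 is empty. *)
Definition persistent_betti k (K : R -> {set {set V}}) (s t : R) : nat :=
  if 0 < s then persistent_rank F k (K s) (K t) else 0%N.

(* D is the multiset of (birth, death) pairs in Omega of the k-dimensional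
   persistent homology of K: by inclusion-exclusion, the multiplicity of (b, d)
   is, for all small e > 0,
   beta(b+e,d-e) - beta(b-e,d-e) - beta(b+e,d+e) + beta(b-e,d+e). *)
Definition is_persistence_diagram k (K : R -> {set {set V}}) (D : diagram R) :=
  forall b d : R, Omega (b, d) -> \forall e \near (0 : R)^'+,
    (D (b, d) + persistent_betti k K (b - e) (d - e)
       + persistent_betti k K (b + e) (d + e) =
     persistent_betti k K (b + e) (d - e)
       + persistent_betti k K (b - e) (d + e))%N.

End persistence.

(* Point clouds are finite subsets of a metric space, with the sigma-field
   generated by the numbers of points in Borel sets. *)
Definition point_cloud_generators (R : realType) (S : metricType R)
    : set (set {fset S}) :=
  [set G | exists (A : set S) (j : nat), <<s open >> A /\
    G = [set c : {fset S} | #|` [fset x in c | x \in A]%fset| = j]].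

Notation PC S := (g_sigma_algebraType (@point_cloud_generators _ S)).

Notation leb2 R :=
  ((@lebesgue_measure R \x @lebesgue_measure R)%E).

(* All iterated directional derivatives exist and are differentiable. *)
Definition smooth (R : realType) (f : R * R -> R) : Prop :=
  forall (vs : seq (R * R)) (z : R * R),
    differentiable (foldr (fun v g => 'D_v g) f vs) z.

(* w is the extension to the plane of the weight given on OmegaM M. *)
Record is_weight (R : realType) (M : R) (w : R * R -> R) : Prop := IsWeight {
  weight_gt0 : forall z, OmegaM M z -> 0 < w z;
  weight_nondecreasing : forall z z', OmegaM M z -> OmegaM M z' ->
    z.2 - z.1 <= z'.2 - z'.1 -> w z <= w z';
  weight_sqr_bounded :
    ('N[leb2 R]_+oo [(fun z => (w z ^+ 2)%:E) \_ (OmegaM M)] < +oo)%E;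
  weight_smooth : smooth w;
  weight_compact_support : compact (closure [set z | w z != 0])
}.

Definition positive_definite (R : realType) (k : R -> R) : Prop :=
  forall (l : nat) (x c : 'I_l -> R),
    0 <= \sum_(i < l) \sum_(j < l) c i * c j * k (x i - x j).

Record is_kernel_profile (R : realType) (k : R -> R) : Prop := IsKernelProfile {
  profile_ge0 : forall x, 0 <= k x;
  profile_positive_definite : positive_definite k;
  profile_L1 : k \in Lfun (@lebesgue_measure R) 1%E;
  profile_L2 : k \in Lfun (@lebesgue_measure R) 2%:E;
  profile_even : forall x, k x = k (- x);
  profile_integral : (\int[@lebesgue_measure R]_x (k x)%:E = 1)%E
}.

Section distribution_class.
Variables (R : realType) (F : fieldType) (M N : R) (w : R * R -> R).

Section conditional_density.
Context d (T : measurableType d) (Pr : probability T R).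

(* E[D(A) | Z = l], meaningful when Pr (Z = l) is not zero. *)
Definition conditional_intensity (D : T -> diagram R) (Z : T -> nat) (l : nat)
    (A : set (R * R)) : \bar R :=
  (((fine (Pr (Z @^-1` [set l])))^-1)%:E *
   \int[Pr]_(o in Z @^-1` [set l]) diagram_count (D o) A)%E.

Definition is_conditional_density (D : T -> diagram R) (Z : T -> nat) (l : nat)
    (p : R * R -> R) : Prop :=
  [/\ forall z, 0 <= p z, measurable_fun setT p &
   forall A, measurable A -> A `<=` Omega ->
     conditional_intensity D Z l A = (\int[leb2 R]_(z in A) (p z)%:E)%E].

Definition dominated_intensity (D : T -> diagram R) : Prop :=
  exists (Z : {RV Pr >-> nat}) (h : nat -> R) (p : nat -> R * R -> R),
  [/\ forall o, (0 < Z o)%N,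
      forall l, {ae Pr, forall o, Z o = l ->
        (diagram_count (D o) setT <= (h l)%:E)%E},
      forall l, Pr (Z @^-1` [set l]) != 0%E ->
        is_conditional_density D Z l (p l) &
      (\sum_(1 <= l <oo)
         (h l)%:E * 'N[leb2 R]_+oo [(fun z => (w z ^+ 2 * p l z)%:E) \_ (OmegaM M)]
         * Pr (Z @^-1` [set l]) <= N%:E)%E].

End conditional_density.

Definition in_class (P : probability (PD R) R) : Prop :=
  exists (d : measure_display) (T : measurableType d) (Pr : probability T R)
    (k : nat) (S : metricType R)
    (K : forall c : {fset S}, R -> {set {set c}})
    (PDk : {mfun PC S >-> PD R}) (X : {RV Pr >-> PC S}),
  let D := fun o => PDk (X o) in
  [/\ forall c, is_filtration (K c) /\ is_persistence_diagram F k (K c) (PDk c),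
      forall A : set (PD R), measurable A -> P A = Pr (D @^-1` A),
      {ae Pr, forall o, forall z, D o z != 0%N -> z.2 < M} &
      dominated_intensity Pr D].

End distribution_class.

Section test.
Variables (R : realType) (w : R * R -> R) (k1 k2 : R -> R) (lam : R * R).

Definition phi_lambda (u : R * R) : R :=
  (lam.1^-1 * k1 (u.1 / lam.1)) * (lam.2^-1 * k2 (u.2 / lam.2)).

Definition k_lambda (x y : R * R) : R := phi_lambda (x - y).

(* The distinct points of D when there are finitely many, and fset0 otherwise
   (almost surely not the case for distributions in the class). *)
Definition diagram_points (D : diagram R) : {fset R * R} :=
  fset_set [set z | D z != 0%N].

Definition K_lambda (X Y : diagram R) : R :=
  \sum_(z <- diagram_points X) \sum_(z' <- diagram_points Y)
    (X z)%:R * (Y z')%:R * (w z * w z' * k_lambda z z').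

Definition h_lambda (X X' Y Y' : diagram R) : R :=
  K_lambda X X' + K_lambda Y Y' - K_lambda X Y' - K_lambda X' Y.

Variables n m : nat.

Definition T_hat (X : 'I_n -> diagram R) (Y : 'I_m -> diagram R) : R :=
  (n%:R * (n%:R - 1) * m%:R * (m%:R - 1))^-1 *
  \sum_(i < n) \sum_(i' < n | i != i') \sum_(j < m) \sum_(j' < m | j != j')
    h_lambda (X i) (X i') (Y j) (Y j').

Definition pooled (X : 'I_n -> diagram R) (Y : 'I_m -> diagram R)
    (i : 'I_(n + m)) : diagram R :=
  match fintype.split i with inl i1 => X i1 | inr i2 => Y i2 end.

Definition T_perm (X : 'I_n -> diagram R) (Y : 'I_m -> diagram R)
    (s : 'S_(n + m)) : R :=
  T_hat (fun i => pooled X Y (s (lshift m i)))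
        (fun j => pooled X Y (s (rshift n j))).

Variables (alpha : R) (B : nat).

(* T^1, ..., T^B, T^(B+1); the index b : 'I_B.+1 is shifted by one. *)
Definition T_all (X : 'I_n -> diagram R) (Y : 'I_m -> diagram R)
    (s : 'I_B -> 'S_(n + m)) (b : 'I_B.+1) : R :=
  if unlift ord_max b is Some b' then T_perm X Y (s b') else T_hat X Y.

Definition q_hat (X : 'I_n -> diagram R) (Y : 'I_m -> diagram R)
    (s : 'I_B -> 'S_(n + m)) : R :=
  inf [set u : R | 1 - alpha <=
    (B.+1%:R)^-1 * \sum_(b < B.+1) (T_all X Y s b <= u)%R%:R].

Definition Delta (X : 'I_n -> diagram R) (Y : 'I_m -> diagram R)
    (s : 'I_B -> 'S_(n + m)) : nat :=
  (q_hat X Y s < T_hat X Y)%R.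

End test.

Definition mutually_independent (R : realType) d (T : measurableType d)
    (Pr : probability T R) (I : finType) (E : I -> set (set T)) : Prop :=
  forall (J : {set I}) (A : I -> set T), (forall i, i \in J -> E i (A i)) ->
    Pr (\bigcap_(i in [set` J]) A i) = (\prod_(i in J) Pr (A i))%E.

Section sampling.
Context (R : realType) d (T : measurableType d) (Pr : probability T R).
Context (n m B : nat).
Variables (P : probability (PD R) R).
Variables (X : 'I_n -> {RV Pr >-> PD R}) (Y : 'I_m -> {RV Pr >-> PD R}).
Variable s : 'I_B -> T -> 'S_(n + m).

Definition is_uniform_permutation (t : T -> 'S_(n + m)) : Prop :=
  forall g, measurable (t @^-1` [set g]) /\
            Pr (t @^-1` [set g]) = (((n + m)`!%:R : R)^-1)%:E.

Definition sample_events (a : 'I_n + 'I_m + 'I_B) : set (set T) :=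
  match a with
  | inl (inl i) => preimage_set_system setT (X i) measurable
  | inl (inr j) => preimage_set_system setT (Y j) measurable
  | inr b => preimage_set_system setT (s b) setT
  end.

Definition null_sampling : Prop :=
  [/\ forall i (A : set (PD R)), measurable A -> distribution Pr (X i) A = P A,
      forall j (A : set (PD R)), measurable A -> distribution Pr (Y j) A = P A,
      forall b, is_uniform_permutation (s b) &
      mutually_independent Pr sample_events].

End sampling.

(* Main.v *)
Require Import Defs.
From HB Require Import structures.
From mathcomp Require Import all_boot all_order all_algebra all_fingroup finmap.
From mathcomp Require Import all_classical all_reals all_analysis.
From mathcomp Require Import measurable_realfun.
From mathcomp Require Import lra.

Set Implicit Arguments.
Unset Strict Implicit.
Unset Printing Implicit Defensive.

Import Order.TTheory GRing.Theory Num.Theory.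
Import numFieldNormedType.Exports.

Local Open Scope classical_set_scope.
Local Open Scope ring_scope.

(* Write U for the pooled sample. Under the null hypothesis U has the law of U o h
   for every permutation h, independently of the permutations drawn by the test,
   so h may be averaged over the whole group. The statistics then are those of
   B + 1 independent uniform permutations h, g_1 h, ..., g_B h, among which h is
   exchangeable, and whatever the data at most alpha (B + 1) of B + 1 real numbers
   exceed their empirical (1 - alpha)-quantile.

   The rejection event must be measurable for this argument. A diagram with
   finitely many points is a finite sum of Dirac masses, and after normalization
   these form a finite kernel from PD to the plane; integrating the weighted
   kernel against it twice shows that K_lambda is measurable on PD x PD. *)

(** * Ranks and permutations *)

Section order_statistics.
Context {R : realType} (alpha : R) (B : nat).
Hypotheses (alpha_gt0 : 0 < alpha) (alpha_lt1 : alpha < 1).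

(* The infimum is attained at some [t b], so only order relations between the
   [t b] and [x] matter; this is what makes the rejection event measurable. *)
Lemma inf_quantile_lt (t : 'I_B.+1 -> R) (x : R) :
  (inf [set u : R | (1 - alpha <=
      (B.+1%:R)^-1 * \sum_(b < B.+1) (t b <= u)%R%:R)%R] < x) =
  (1 - alpha <= (B.+1%:R)^-1 * \sum_(b < B.+1) (t b < x)%R%:R).
Proof.
set S := [set u | _].
have B1_gt0 : 0 < (B.+1%:R)^-1 :> R by rewrite invr_gt0 ltr0n.
have normt b : `|t b| <= \sum_b `|t b|.
  by rewrite (bigD1 b)//= lerDl sumr_ge0.
have S0 : S !=set0.
  (* This level dominates every [t b], so the empirical frequency is 1; below its opposite the
     frequency is 0, which is less than 1 - alpha. *)
  exists (\sum_b `|t b|); rewrite /S/=.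
  rewrite (eq_bigr (fun=> 1)); last first.
    by move=> b _; rewrite (le_trans (ler_norm _) (normt b)).
  by rewrite sumr_const card_ord mulVf ?pnatr_eq0// gerBl ltW.
have Slb : has_lbound S.
  exists (- \sum_b `|t b|) => u; rewrite /S/= => Su.
  rewrite leNgt; apply/negP => u_lt; move: Su; rewrite big1 ?mulr0.
    by rewrite leNgt subr_gt0 alpha_lt1.
  move=> b _; rewrite leNgt (lt_le_trans u_lt)//.
  by rewrite lerNl (le_trans _ (normt b))// -normrN ler_norm.
apply/idP/idP => [infS|rej].
  have [u Su ux] := inf_lt S0 infS.
  apply: (le_trans Su); rewrite ler_pM2l// ler_sum// => b _.
  by rewrite ler_nat; have [/le_lt_trans ->|] := boolP (t b <= u).
have [b0 tb0] : exists b, t b < x.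
  apply: contrapT => /forallNP nt; move: rej; rewrite big1 ?mulr0.
    by rewrite leNgt subr_gt0 alpha_lt1.
  by move=> b _; have /negP/negbTE -> := nt b.
(* The largest [t b] below [x] belongs to [S]: each [t i] below [x] is at most [t b], so the
   frequency at level [t b] is still large enough. *)
have [b tbx tb_max] := @arg_maxP _ _ _ _ [pred b | t b < x] t tb0.
apply: (@le_lt_trans _ _ (t b)) => //; apply: ge_inf => //.
rewrite /S/=; apply: (le_trans rej); rewrite ler_pM2l// ler_sum// => i _.
by rewrite ler_nat; have [/tb_max/= ->|] := boolP (t i < x).
Qed.

(** Let [t j] be the least value that rejects, if there is one. At least (1 - alpha)(B + 1) values
    lie strictly below it and none of these rejects, so at most alpha (B + 1) values remain. *)
Lemma sum_rejections_le (t : 'I_B.+1 -> R) :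
  \sum_(j < B.+1)
    (1 - alpha <= (B.+1%:R)^-1 * \sum_(b < B.+1) (t b < t j)%R%:R)%R%:R
  <= alpha * B.+1%:R.
Proof.
pose rej j := 1 - alpha <= (B.+1%:R)^-1 * \sum_(b < B.+1) (t b < t j)%R%:R.
have [/existsP[j0 rej0]|/existsPn norej] := boolP [exists j, rej j]; last first.
  rewrite big1; first by rewrite mulr_ge0// ltW.
  by move=> j _; rewrite -/(rej j) (negbTE (norej j)).
have [j rejj t_min] := @arg_minP _ _ _ _ rej t rej0.
rewrite -/(rej _) in rejj *.
have : (1 - alpha) * B.+1%:R <= \sum_(b < B.+1) (t b < t j)%R%:R.
  by rewrite -ler_pdivlMr ?ltr0n// mulrC.
rewrite mulrBl mul1r lerBlDl -lerBlDr => /(le_trans _); apply.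
rewrite lerBrDr -big_split/= -[leRHS](_ : \sum_(b < B.+1) 1 = _); last first.
  by rewrite sumr_const card_ord.
apply: ler_sum => i _; rewrite -/(rej i).
have [/t_min|_] := boolP (rej i).
  by rewrite leNgt => /negbTE ->; rewrite addr0.
by rewrite add0r lern1 leq_b1.
Qed.

(* The map [(h, g) |-> (g_1 h, ..., g_B h, h)] turns a uniform family of
   permutations applied to a uniform relabelling into B + 1 independent uniform
   permutations, whose indices are exchangeable. *)
Lemma sum_group_rejections_le (G : finGroupType) (v : G -> R) :
  \sum_(g : {ffun 'I_B -> G}) \sum_(h : G)
    (1 - alpha <= (B.+1%:R)^-1 * \sum_(b < B.+1)
      (v (if unlift ord_max b is Some b' then (g b' * h)%g else h) < v h)%R%:R)%R%:R
  <= alpha * #|G|%:R ^+ B.+1.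
Proof.
pose rej (f : {ffun 'I_B.+1 -> G}) j :=
  (1 - alpha <= (B.+1%:R)^-1 * \sum_(b < B.+1) (v (f b) < v (f j))%R%:R)%R.
pose join (p : {ffun 'I_B -> G} * G) : {ffun 'I_B.+1 -> G} :=
  [ffun b => if unlift ord_max b is Some b' then (p.1 b' * p.2)%g else p.2].
pose part (f : {ffun 'I_B.+1 -> G}) : {ffun 'I_B -> G} * G :=
  ([ffun b => (f (lift ord_max b) * (f ord_max)^-1)%g], f ord_max).
have joinK : cancel join part.
  move=> [g h]; congr (_, _); last by rewrite ffunE unlift_none.
  by apply/ffunP => b; rewrite !ffunE liftK unlift_none/= mulgK.
have partK : cancel part join.
  move=> f; apply/ffunP => b; rewrite ffunE/=.
  by case: unliftP => [b' ->|->//]; rewrite ffunE mulgKV.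
have -> : \sum_(g : {ffun 'I_B -> G}) \sum_(h : G)
    (1 - alpha <= (B.+1%:R)^-1 * \sum_(b < B.+1)
      (v (if unlift ord_max b is Some b' then (g b' * h)%g else h) < v h)%R%:R)%R%:R
    = \sum_f (rej f ord_max)%:R :> R.
  rewrite pair_bigA/= [RHS](reindex join); last first.
    by exists part => ? _; [exact: joinK|exact: partK].
  apply: eq_bigr => -[g h] _ /=; congr (nat_of_bool (_ <= _ * _))%:R.
  by apply: eq_bigr => b _; rewrite !ffunE unlift_none.
(* Swapping the coordinates [j] and [ord_max] of [f] is an involution that leaves the multiset of
   the values [v (f b)] unchanged. *)
have symm j : \sum_f (rej f j)%:R = \sum_f (rej f ord_max)%:R :> R.
  pose sw (f : {ffun 'I_B.+1 -> G}) : {ffun 'I_B.+1 -> G} :=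
    [ffun b => f (tperm j ord_max b)].
  have swK : involutive sw by move=> f; apply/ffunP => b; rewrite !ffunE tpermK.
  rewrite [RHS](reindex_inj (inv_inj swK))/=; apply: eq_bigr => f _.
  rewrite /rej; congr (nat_of_bool (_ <= _ * _))%:R.
  rewrite (reindex_inj (@perm_inj _ (tperm j ord_max)))/=.
  by apply: eq_bigr => b _; rewrite !ffunE tpermR.
(* By symmetry, summing over [j] multiplies the count for [ord_max] by B + 1, and this factor
   cancels the one in the bound for each [f]. *)
have : \sum_(f : {ffun 'I_B.+1 -> G}) \sum_j (rej f j)%:R <=
    \sum_(f : {ffun 'I_B.+1 -> G}) alpha * B.+1%:R :> R.
  by apply: ler_sum => f _; exact: sum_rejections_le.
rewrite exchange_big/= (eq_bigr _ (fun j _ => symm j)) !sumr_const card_ord.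
rewrite card_ffun card_ord -[leLHS]mulr_natr -[leRHS]mulr_natr natrX.
by rewrite mulrAC ler_pM2r ?ltr0n.
Qed.

End order_statistics.

(** * Measurability on the plane and on diagrams *)

Section plane.
Context {R : realType}.

(** The plane is second countable: an open set is the union of the countably many boxes with
    rational centre and radius 1/(k + 1) that it contains. *)
Lemma open_measurable_prod (A : set (R * R)) : open A -> measurable A.
Proof.
move=> oA.
pose box (q : rat * rat * nat) : set (R * R) :=
  ball (ratr q.1.1 : R) q.2.+1%:R^-1 `*` ball (ratr q.1.2 : R) q.2.+1%:R^-1.
have -> : A = \bigcup_(q in [set q | box q `<=` A]) box q.
  apply/seteqP; split => [[x y] Axy|z [q qA]]; last exact: qA.
  have /nbhs_ballP[e /= e0 eA] : nbhs (x, y) A by exact: open_nbhs_nbhs.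
  (* With radius below e/2, every box that contains (x, y) lies in the ball of radius e around
     it. *)
  have [k ke] : exists k : nat, k.+1%:R^-1 < e / 2.
    have /ltr_add_invr[k] : 0 < e / 2 by rewrite divr_gt0.
    by rewrite add0r => ke; exists k.
  have k0 : 0 < k.+1%:R^-1 :> R by rewrite invr_gt0 ltr0n.
  have near_rat (t : R) : exists p : rat, ball t k.+1%:R^-1 (ratr p : R).
    have [||z [bt [p _ pz]]] := @dense_rat R (ball t k.+1%:R^-1).
    - by exists t; exact: ballxx.
    - exact: ball_open.
    by exists p; rewrite pz.
  have [p xp] := near_rat x; have [q yq] := near_rat y.
  exists (p, q, k); last by split; exact: ball_sym.
  move=> [u v] /= [/= pu qv]; apply: eA; split => /=.
    apply: (@le_ball _ _ _ (k.+1%:R^-1 + k.+1%:R^-1)).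
      by rewrite (splitr e) lerD// ltW.
    exact: ball_triangle xp pu.
  apply: (@le_ball _ _ _ (k.+1%:R^-1 + k.+1%:R^-1)).
    by rewrite (splitr e) lerD// ltW.
  exact: ball_triangle yq qv.
rewrite bigcup_mkcond; apply: countable_bigcupT_measurable => // q.
by case: ifPn => // _; apply: measurableX; exact: measurable_ball.
Qed.

Lemma continuous_measurable_prod (f : R * R -> R) :
  continuous f -> measurable_fun setT f.
Proof.
move=> cf; apply: (measurability _ (RGenOpens.measurableE R)).
move=> _ [_ [a [b ->] <-]]; rewrite setTI; apply: open_measurable_prod.
by apply: open_comp => [x _|]; [exact: cf|exact: interval_open].
Qed.

Lemma smooth_measurable (f : R * R -> R) : smooth f -> measurable_fun setT f.
Proof.
move=> sf; apply: continuous_measurable_prod => z.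
exact: differentiable_continuous (sf [::] z).
Qed.

(** Closed pieces of Omega, bounded and kept away from the diagonal. Counts on their measurable
    subsets are measurable by the choice of generators, whereas Omega is not relatively compact in
    itself. *)
Definition Omega_exhaustion (n : nat) : set (R * R) :=
  [set z | [/\ 0 <= z.1, z.1 + n.+1%:R^-1 <= z.2 & z.2 <= n%:R]].

Lemma Omega_exhaustion_Omega n : Omega_exhaustion n `<=` Omega.
Proof.
move=> z [z10 z12 _]; split => //.
by apply: lt_le_trans z12; rewrite ltrDl invr_gt0 ltr0n.
Qed.

Lemma nondecreasing_Omega_exhaustion : nondecreasing_seq Omega_exhaustion.
Proof.
move=> p q pq; apply/subsetPset => z [z10 z12 z2p]; split => //.
  by apply: le_trans z12; rewrite lerD2l lef_pV2 ?posrE ?ltr0n// ler_nat ltnS.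
by rewrite (le_trans z2p)// ler_nat.
Qed.

Lemma Omega_bigcup : @Omega R = \bigcup_n Omega_exhaustion n.
Proof.
apply/seteqP; split => [z [z12 z10]|z [n _]]; last first.
  exact: Omega_exhaustion_Omega.
have /ltr_add_invr[k] : 0 < z.2 - z.1 by rewrite subr_gt0.
rewrite add0r ltrBrDl => /ltW kz.
have z20 : 0 <= z.2 by rewrite ltW// (le_lt_trans z10).
exists (maxn k (Num.truncn z.2).+1) => //; split => //.
- apply: le_trans kz; rewrite lerD2l lef_pV2 ?posrE ?ltr0n// ler_nat ltnS.
  exact: leq_maxl.
- rewrite (@le_trans _ _ (Num.truncn z.2).+1%:R)//.
    by rewrite ltW// truncnS_gt.
  by rewrite ler_nat leq_maxr.
Qed.

Lemma closed_Omega_exhaustion n : closed (Omega_exhaustion n).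
Proof.
have -> : Omega_exhaustion n =
    (fst @^-1` [set x : R | 0 <= x]) `&`
    ((fun z : R * R => z.2 - z.1) @^-1` [set x : R | n.+1%:R^-1 <= x]) `&`
    (snd @^-1` [set x : R | x <= n%:R]).
  apply/seteqP; split => z.
    by move=> [z1 z12 z2]; split => //; split => //=; rewrite lerBrDl.
  by move=> [[z1 /=]]; rewrite lerBrDl.
apply: closedI; [apply: closedI|]; apply: closed_comp => //.
- by move=> z _; exact: cvg_fst.
- by move=> z _; apply: cvgB; [exact: cvg_snd|exact: cvg_fst].
- by move=> z _; exact: cvg_snd.
Qed.

Lemma measurable_Omega_exhaustion n : measurable (Omega_exhaustion n).
Proof.
rewrite -[X in measurable X]setCK; apply: measurableC.
by apply: open_measurable_prod; rewrite openC; exact: closed_Omega_exhaustion.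
Qed.

Lemma measurable_Omega : measurable (@Omega R).
Proof.
rewrite Omega_bigcup; apply: bigcup_measurable => n _.
exact: measurable_Omega_exhaustion.
Qed.

Lemma relatively_compact_Omega_exhaustion n (A : set (R * R)) :
  relatively_compact_in_Omega (A `&` Omega_exhaustion n).
Proof.
have clA : closure (A `&` Omega_exhaustion n) `<=` Omega_exhaustion n.
  rewrite [X in _ `<=` X](iffLR (closure_id _)); last exact: closed_Omega_exhaustion.
  by apply: closure_subset; exact: subIsetr.
split; last by apply: subset_trans clA _; exact: Omega_exhaustion_Omega.
apply: (@subclosed_compact _ _ ([set` `[0, n%:R : R]] `*` [set` `[0, n%:R : R]])).
- exact: closed_closure.
- by apply: compact_setX; exact: segment_compact.
apply: subset_trans clA _ => z En; have [z10 z12 z2n] := En.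
have [{}z12 _] := Omega_exhaustion_Omega En.
split; rewrite /= in_itv/=.
  by rewrite z10 (le_trans (ltW z12)).
by rewrite z2n (le_trans z10 (ltW z12)).
Qed.

End plane.

(** * Diagrams as finite sums of Dirac masses *)

Section diagram_sums.
Context {R : realType}.

Let supp (D : diagram R) := [set z | D z != 0%N].

(** For a diagram with infinitely many points [diagram_points] is empty and the sum is 0, the same
    convention as in [K_lambda]. *)
Definition diagram_sum (D : diagram R) (f : R * R -> R) : R :=
  \sum_(z <- diagram_points D) (D z)%:R * f z.

Definition diagram_measure (D : diagram R) :
    {measure set (R * R) -> \bar R} :=
  msum (fun i => mscale (D (nth (0, 0) (diagram_points D) i))%:R%:nng
                        (dirac (nth (0, 0) (diagram_points D) i)))
       (size (diagram_points D)).

Lemma integral_diagram_measure (D : diagram R) (f : R * R -> R) :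
  (forall z, 0 <= f z) -> measurable_fun setT f ->
  (\int[diagram_measure D]_z (f z)%:E = (diagram_sum D f)%:E)%E.
Proof.
move=> f0 mf.
have mEf : measurable_fun setT (EFin \o f) by exact/measurable_EFinP.
rewrite ge0_integral_measure_sum//; last by move=> z _; rewrite lee_fin.
rewrite /diagram_sum (big_nth (0, 0)) big_mkord -sumEFin.
apply: eq_bigr => i _.
rewrite ge0_integral_mscale//=; last by move=> z _; rewrite lee_fin.
by rewrite integral_dirac// diracT mul1e.
Qed.

Lemma diagram_measureE (D : diagram R) (A : set (R * R)) : measurable A ->
  diagram_measure D A = (diagram_sum D \1_A)%:E.
Proof.
move=> mA; rewrite -integral_diagram_measure.
- by rewrite integral_indic// setIT.
- by move=> z; rewrite indicE.
- exact: measurable_indic.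
Qed.

Lemma diagram_count_finite (D : diagram R) (A : set (R * R)) :
  finite_set (supp D) -> diagram_count D A = (diagram_sum D \1_A)%:E.
Proof.
move=> fD; rewrite /diagram_count esum_mkcond.
rewrite (eq_esum (b := fun z => if z \in supp D
    then ((D z)%:R * \1_A z)%:E else 0%E)); last first.
  move=> z _; rewrite indicE; case: ifPn => zA; last by rewrite mulr0 if_same.
  rewrite mulr1; case: ifPn => // /negP zD.
  have [->//|Dz] := eqVneq (D z) 0%N.
  by exfalso; apply: zD; rewrite inE.
by rewrite -esum_mkcond esum_fset// fsbig_finite// -sumEFin.
Qed.

Lemma diagram_sum_infinite (D : diagram R) (f : R * R -> R) :
  infinite_set (supp D) -> diagram_sum D f = 0.
Proof.
move=> iD; rewrite /diagram_sum /diagram_points /fset_set.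
by case: pselect => // _; rewrite big_nil.
Qed.

(** Finiteness is expressed through countably many measurable counts. Conversely, if the support is
    infinite, it contains c + 1 points, which all lie in a single set of the increasing
    exhaustion. *)
Lemma finite_diagramP (D : diagram R) :
  finite_set (supp D) <->
  exists c : nat, forall n, (diagram_count D (Omega_exhaustion n) <= c%:R%:E)%E.
Proof.
split=> [fD|[c Dc]].
  exists (\sum_(z <- diagram_points D) D z)%N => n.
  rewrite diagram_count_finite// lee_fin /diagram_sum natr_sum ler_sum// => z _.
  by rewrite ler_piMr// indicE; case: (_ \in _).
apply: contrapT => iD.
have [F FD cF] := infinite_set_fset c.+1 iD.
have [n FE] : exists n, [set` F] `<=` Omega_exhaustion n.
  have /choice[e eE] (z : R * R) : exists n, z \in F -> Omega_exhaustion n z.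
    have [zF|_] := boolP (z \in F); last by exists 0%N.
    have : @Omega R z by apply: diagram_support; exact: FD.
    by rewrite Omega_bigcup => -[n _ nz]; exists n.
  exists (\max_(z <- F) e z)%N => z /= zF.
  have /subsetPset : (Omega_exhaustion (e z) <=
      @Omega_exhaustion R (\max_(z <- F) e z)%N)%O.
    by apply: nondecreasing_Omega_exhaustion; rewrite leq_bigmax_seq.
  by apply; exact: eE.
have : (c.+1%:R%:E <= diagram_count D (Omega_exhaustion n))%E.
  apply: esum_ge; exists [set` F]; first by split.
  rewrite fsbig_finite// set_fsetK sumEFin lee_fin.
  apply: (@le_trans _ _ (#|` F|%:R)); first by rewrite ler_nat.
  rewrite card_fset_sum1 natr_sum big_seq [leRHS]big_seq.
  by apply: ler_sum => z /FD/=; rewrite ler_nat lt0n.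
move=> /le_trans /(_ (Dc n)); rewrite lee_fin ler_nat.
by rewrite ltnn.
Qed.

Lemma measurable_diagram_count (A : set (R * R)) :
  measurable A -> relatively_compact_in_Omega A ->
  measurable_fun setT (fun D : PD R => diagram_count D A).
Proof.
move=> mA rA _ C mC; rewrite setTI; apply: sub_sigma_algebra.
by exists A, C.
Qed.

Lemma measurable_diagram_count_exhaustion (A : set (R * R)) n :
  measurable A ->
  measurable_fun setT (fun D : PD R =>
    diagram_count D (A `&` Omega_exhaustion n)).
Proof.
move=> mA; apply: measurable_diagram_count.
  by apply: measurableI => //; exact: measurable_Omega_exhaustion.
exact: relatively_compact_Omega_exhaustion.
Qed.

Lemma measurable_finite_diagram :
  measurable ([set D | finite_set (supp D)] : set (PD R)).
Proof.
rewrite (_ : [set D | _] = \bigcup_c \bigcap_n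
    [set D : PD R | (diagram_count D (Omega_exhaustion n) <= c%:R%:E)%E]).
  apply: bigcup_measurable => c _; apply: bigcap_measurable => // n _.
  rewrite -[X in measurable X]setTI; apply: measurable_lee => //.
  rewrite (_ : (fun _ => _) = fun D : PD R =>
      diagram_count D (setT `&` Omega_exhaustion n)); last by rewrite setTI.
  exact: measurable_diagram_count_exhaustion.
apply/seteqP; split => D.
  by move=> /finite_diagramP[c Dc]; exists c => // n _; exact: Dc.
by move=> [c _ Dc]; apply/finite_diagramP; exists c => n; exact: Dc.
Qed.

(** On finite diagrams the mass of [A] is the limit of the counts on [A] cut by the exhaustion, by
    continuity from below; on infinite ones both sides are 0. This is a pointwise limit of
    measurable functions. *)
Lemma measurable_diagram_measure (A : set (R * R)) : measurable A ->
  measurable_fun setT (fun D : PD R => diagram_measure D A).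
Proof.
move=> mA.
pose g n (D : PD R) : \bar R :=
  if `[< finite_set (supp D) >]
  then diagram_count D (A `&` Omega_exhaustion n) else 0%E.
apply: (@emeasurable_fun_cvg _ _ _ _ g) => [n|D _].
  apply: measurable_fun_ifT => //.
    apply: (measurable_fun_bool true); rewrite setTI.
    rewrite (_ : _ @^-1` _ = [set D | finite_set (supp D)]).
      exact: measurable_finite_diagram.
    by apply/seteqP; split => D /asboolP.
  exact: measurable_diagram_count_exhaustion.
have mAE n : measurable (A `&` @Omega_exhaustion R n).
  by apply: measurableI => //; exact: measurable_Omega_exhaustion.
have [fD|iD] := pselect (finite_set (supp D)); last first.
  rewrite /g asboolF// diagram_measureE// diagram_sum_infinite//.
  exact: cvg_cst.
have -> : g ^~ D = diagram_measure D \o (fun n => A `&` Omega_exhaustion n).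
  apply/funext => n/=.
  by rewrite /g asboolT// diagram_count_finite// diagram_measureE.
(* All atoms lie in Omega, so [A] may be replaced by its intersection with Omega. *)
have -> : diagram_measure D A =
    diagram_measure D (\bigcup_n (A `&` Omega_exhaustion n)).
  have mAO : measurable (A `&` @Omega R).
    by apply: measurableI => //; exact: measurable_Omega.
  rewrite -setI_bigcupr -Omega_bigcup !diagram_measureE//.
  congr (_%:E); apply: eq_big_seq => z.
  rewrite in_fset_set// inE => Dz.
  congr (_ * _); rewrite !indicE in_setI.
  by rewrite [z \in Omega]mem_set ?andbT//; exact: diagram_support Dz.
apply: nondecreasing_cvg_mu => //; first exact: bigcup_measurable.
move=> p q pq; apply/subsetPset; apply: setIS.
by apply/subsetPset; exact: nondecreasing_Omega_exhaustion.
Qed.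

Definition diagram_mass (D : diagram R) : R := diagram_sum D (cst 1).

Lemma diagram_mass_ge0 (D : diagram R) : 0 <= diagram_mass D.
Proof. by apply: sumr_ge0 => z _; rewrite mulr_ge0. Qed.

Lemma diagram_measureT (D : diagram R) :
  diagram_measure D setT = (diagram_mass D)%:E.
Proof. by rewrite diagram_measureE// indicT. Qed.

Lemma measurable_diagram_mass :
  measurable_fun setT (fun D : PD R => diagram_mass D).
Proof.
apply/measurable_EFinP; apply: eq_measurable_fun; last first.
  exact: measurable_diagram_measure measurableT.
by move=> D _ /=; rewrite diagram_measureT.
Qed.


Lemma inv_diagram_mass_ge0 (D : diagram R) : 0 <= (1 + diagram_mass D)^-1.
Proof. by rewrite invr_ge0 addr_ge0// diagram_mass_ge0. Qed.

End diagram_sums.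

(** * Integration against a measurable family of diagrams *)

Section diagram_kernel.
Context {R : realType} d (X : measurableType d) (phi : {mfun X >-> PD R}).

(* Dividing by one plus the total mass makes the family uniformly bounded, hence
   a finite kernel. *)
Definition diagram_kernel (x : X) : {measure set (R * R) -> \bar R} :=
  mscale (NngNum (inv_diagram_mass_ge0 (phi x))) (diagram_measure (phi x)).

Let measurable_diagram_kernel U : measurable U ->
  measurable_fun setT (diagram_kernel ^~ U).
Proof.
move=> mU; apply: emeasurable_funM.
  apply/measurable_EFinP => /=.
  (* The inverse is written as a real power, which is measurable on the whole line. *)
  have -> : (fun x => (1 + diagram_mass (phi x))^-1) =
      (fun r : R => r `^ (-1)) \o (fun x => 1 + diagram_mass (phi x)).
    by apply/funext => x /=; rewrite powR_inv1// addr_ge0// diagram_mass_ge0.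
  apply: measurableT_comp; first exact: measurable_powR.
  apply: measurable_funD => //.
  exact: measurableT_comp measurable_diagram_mass _.
exact: (measurableT_comp (measurable_diagram_measure mU)).
Qed.

HB.instance Definition _ := isKernel.Build _ _ _ _ _ diagram_kernel
  measurable_diagram_kernel.

Let diagram_kernel_uub : measure_fam_uub diagram_kernel.
Proof.
(* The normalized mass is m / (1 + m), below 1 and so strictly below 2. *)
exists 2 => x; rewrite /diagram_kernel/= /mscale/=.
rewrite [diagram_measure _ _]diagram_measureT -EFinM lte_fin.
have m0 := diagram_mass_ge0 (phi x).
by rewrite ltr_pdivrMl ?ltr_wpDr//; lra.
Qed.

HB.instance Definition _ := Kernel_isFinite.Build _ _ _ _ _ diagram_kernel
  diagram_kernel_uub.

(** Multiplying the integral against the finite kernel by one plus the mass undoes the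
    normalization; the integral is measurable in the parameter even though [f] depends on it. *)
Lemma ge0_measurable_diagram_sum (f : X * (R * R) -> R) :
  (forall u, 0 <= f u) -> measurable_fun setT f ->
  measurable_fun setT (fun x => diagram_sum (phi x) (fun z => f (x, z))).
Proof.
move=> f0 mf; apply/measurable_EFinP.
have -> : EFin \o (fun x => diagram_sum (phi x) (fun z => f (x, z))) =
    (fun x => (1 + diagram_mass (phi x))%:E *
              \int[diagram_kernel x]_z (f (x, z))%:E)%E.
  apply/funext => x /=.
  have mfx : measurable_fun setT (fun z => f (x, z)).
    exact: measurableT_comp mf (pair1_measurable x).
  rewrite ge0_integral_mscale//=; last first.
  - by move=> z _; rewrite lee_fin.
  - exact/measurable_EFinP.
  rewrite integral_diagram_measure// -!EFinM mulrA divff ?mul1r//.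
  by rewrite gt_eqF// ltr_wpDr// diagram_mass_ge0.
apply: emeasurable_funM.
  apply/measurable_EFinP; apply: measurable_funD => //.
  exact: measurableT_comp measurable_diagram_mass _.
apply: (measurable_fun_integral_finite_kernel (EFin \o f) diagram_kernel).
  by move=> u; rewrite lee_fin.
exact/measurable_EFinP.
Qed.

Lemma measurable_diagram_sum (f : X * (R * R) -> R) : measurable_fun setT f ->
  measurable_fun setT (fun x => diagram_sum (phi x) (fun z => f (x, z))).
Proof.
move=> mf.
have -> : (fun x => diagram_sum (phi x) (fun z => f (x, z))) =
    (fun x => diagram_sum (phi x) (fun z => f^\+ (x, z)) -
              diagram_sum (phi x) (fun z => f^\- (x, z))).
  apply/funext => x; rewrite /diagram_sum -sumrB; apply: eq_bigr => z _.
  by rewrite -mulrBr -[in LHS](funrposBneg f).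
apply: measurable_funB; apply: ge0_measurable_diagram_sum.
- exact: funrpos_ge0.
- exact: measurable_funrpos.
- exact: funrneg_ge0.
- exact: measurable_funrneg.
Qed.

End diagram_kernel.

(** * Product sigma-algebras *)

Section boxes.
Context d (S : measurableType d) (I : finType).

(** These sets generate the product sigma-algebra on families indexed by [I]. *)
Definition boxes : set (set (I -> S)) :=
  [set G | exists A : I -> set S, (forall i, measurable (A i)) /\
    G = [set u | forall i, A i (u i)]].

Local Notation space := (g_sigma_algebraType boxes).

Lemma measurable_coordinate (i : I) :
  measurable_fun setT (fun u : space => u i).
Proof.
move=> _ A mA; rewrite setTI; apply: sub_sigma_algebra.
exists (fun j => if j == i then A else setT); split.
  by move=> j; case: ifP.
apply/seteqP; split => u /=; last by move=> /(_ i); rewrite eqxx.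
by move=> Aui j; case: eqP => // ->.
Qed.

Lemma measurable_to_boxes d' (T : measurableType d') (U : T -> space) :
  (forall i, measurable_fun setT (fun o => U o i)) -> measurable_fun setT U.
Proof.
move=> mU; apply: (@measurability _ _ _ _ setT U boxes) => //.
move=> _ [_ [A [mA ->]] <-]; rewrite setTI.
have -> : U @^-1` [set u | forall i, A i (u i)] =
    \bigcap_(i in setT) ((fun o => U o i) @^-1` A i).
  by apply/seteqP; split => o /= Ao i; [move=> _; exact: Ao|exact: Ao i Logic.I].
apply: fin_bigcap_measurable => [|i _]; first exact: finite_finset.
by rewrite -[X in measurable X]setTI; exact: mU.
Qed.

(** Boxes are stable under intersection and include the whole space, so the uniqueness theorem for
    finite measures on a pi-system applies. *)
Lemma box_measure_unique (R : realType) (m1 m2 : {measure set space -> \bar R}) :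
  (m1 setT < +oo)%E ->
  (forall A : I -> set S, (forall i, measurable (A i)) ->
    m1 [set u | forall i, A i (u i)] = m2 [set u | forall i, A i (u i)]) ->
  forall E, measurable E -> m1 E = m2 E.
Proof.
move=> m1oo m12; apply: (measure_unique (T := space) boxes (fun=> setT)) => //.
- move=> _ _ [A [mA ->]] [A' [mA' ->]].
  exists (fun i => A i `&` A' i); split; first by move=> i; exact: measurableI.
  by apply/seteqP; split=> u /= => [[Au A'u] i|Au]; [|split => i; have [] := Au i].
- by move=> _; exists (fun=> setT); split => //; apply/seteqP; split.
- by rewrite bigcup_const//; exists 0%N.
- by move=> _ [A [mA ->]]; exact: m12.
Qed.

End boxes.
Arguments boxes {d} S I.

(** * Expected number of events that occur *)

Section counting.
Context d (T : measurableType d) (R : realType) (Pr : probability T R).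

Lemma sum_measureE (I : finType) (A : I -> set T) :
  (forall i, measurable (A i)) ->
  (\sum_i Pr (A i) = \int[Pr]_o (\sum_i \1_(A i) o)%:E)%E.
Proof.
move=> mA; under eq_integral do rewrite -sumEFin.
rewrite ge0_integral_sum//=.
  by apply: eq_bigr => i _; rewrite integral_indic// setIT.
by move=> i; apply/measurable_EFinP; exact: measurable_indic.
Qed.

Lemma sum_measure_le (I : finType) (A : I -> set T) (c : R) :
  (forall i, measurable (A i)) -> (forall o, \sum_i \1_(A i) o <= c) ->
  (\sum_i Pr (A i) <= c%:E)%E.
Proof.
move=> mA Ac; rewrite sum_measureE//.
rewrite -[leRHS]mule1 -(@probability_setT _ _ _ Pr) -integral_cst//.
apply: ge0_le_integral => //=.
- by move=> o _; rewrite lee_fin sumr_ge0// => i _; rewrite indicE.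
- apply/measurable_EFinP; apply: measurable_sum => i.
  exact: measurable_indic.
- by move=> o _; rewrite lee_fin; exact: Ac.
Qed.

End counting.

(** * The permutation test *)

Lemma measurable_sum_cond d (T : measurableType d) (R : realType) (D : set T)
    (I : Type) (s : seq I) (P : pred I) (f : I -> T -> R) :
  (forall i, measurable_fun D (f i)) ->
  measurable_fun D (fun x => \sum_(i <- s | P i) f i x).
Proof.
move=> mf; rewrite (_ : (fun _ => _) =
    fun x => \sum_(i <- s) if P i then f i x else 0); last first.
  by apply/funext => x; rewrite big_mkcond.
by apply: measurable_sum => i; case: (P i).
Qed.

Section test_statistic.
Context {R : realType} (w : R * R -> R) (k1 k2 : R -> R) (lam : R * R).
Hypotheses (w_smooth : smooth w) (mk1 : measurable_fun setT k1)
  (mk2 : measurable_fun setT k2).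
Variables (n m : nat) (alpha : R) (B : nat).

Lemma measurable_k_lambda :
  measurable_fun setT (fun p : (R * R) * (R * R) => k_lambda k1 k2 lam p.1 p.2).
Proof.
apply: measurable_funM; apply: measurable_funM => //.
- apply: measurableT_comp => //; apply: measurable_funM => //.
  apply: measurable_funB; apply: measurableT_comp measurable_fst _;
    [exact: measurable_fst|exact: measurable_snd].
- apply: measurableT_comp => //; apply: measurable_funM => //.
  apply: measurable_funB; apply: measurableT_comp measurable_snd _;
    [exact: measurable_fst|exact: measurable_snd].
Qed.

Lemma measurable_K_lambda :
  measurable_fun setT (fun D : PD R * PD R => K_lambda w k1 k2 lam D.1 D.2).
Proof.
have mw := smooth_measurable w_smooth.
have mfstD : measurable_fun setT (@fst (PD R) (R * R)) by exact: measurable_fst.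
have mfst : measurable_fun setT (@fst (PD R) (PD R)) by exact: measurable_fst.
(* The inner sum, with the point of the outer sum as a parameter. Its joint measurability in diagram
   and point allows a second summation. *)
pose g (v : PD R * (R * R)) : R := diagram_sum v.1
  (fun z => w v.2 * w z * k_lambda k1 k2 lam v.2 z).
have mg : measurable_fun setT g.
  apply: (measurable_diagram_sum (mfun_Sub (mem_set mfstD))
    (f := fun t => w t.1.2 * w t.2 * k_lambda k1 k2 lam t.1.2 t.2)).
  have msnd1 : measurable_fun setT
      (fun t : (PD R * (R * R)) * (R * R) => t.1.2).
    exact: measurableT_comp measurable_snd measurable_fst.
  apply: measurable_funM.
    apply: measurable_funM; first exact: measurableT_comp mw msnd1.
    exact: measurableT_comp mw measurable_snd.
  have mp := measurable_fun_pair msnd1 (@measurable_snd _ _ _ (R * R)%type).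
  exact (measurableT_comp measurable_k_lambda mp).
have -> : (fun D : PD R * PD R => K_lambda w k1 k2 lam D.1 D.2) =
    fun D => diagram_sum D.1 (fun z => g (D.2, z)).
  apply/funext => D; rewrite /K_lambda /diagram_sum; apply: eq_bigr => z _.
  by rewrite /g /diagram_sum mulr_sumr; apply: eq_bigr => z' _; rewrite [RHS]mulrA.
apply: (measurable_diagram_sum (mfun_Sub (mem_set mfst))
    (f := fun t : (PD R * PD R) * (R * R) => g (t.1.2, t.2))).
apply: (measurableT_comp mg); apply: measurable_fun_pair measurable_snd.
exact: measurableT_comp measurable_snd measurable_fst.
Qed.

Definition pooled_stat (u : 'I_(n + m) -> diagram R) : R :=
  T_hat w k1 k2 lam (fun i => u (lshift m i)) (fun j => u (rshift n j)).

Lemma T_hat_pooled (X : 'I_n -> diagram R) (Y : 'I_m -> diagram R) :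
  T_hat w k1 k2 lam X Y = pooled_stat (pooled X Y).
Proof.
rewrite /pooled_stat; congr (T_hat _ _ _ _ _ _); apply/funext => i.
  by rewrite /pooled -[lshift m i]/(unsplit (inl i)) unsplitK.
by rewrite /pooled -[rshift n i]/(unsplit (inr i)) unsplitK.
Qed.

Local Notation space := (g_sigma_algebraType (boxes (PD R) 'I_(n + m))).

Lemma measurable_pooled_stat (h : 'I_(n + m) -> 'I_(n + m)) :
  measurable_fun setT (fun u : space => pooled_stat (u \o h)).
Proof.
have mK i j : measurable_fun setT (fun u : space => K_lambda w k1 k2 lam (u i) (u j)).
  have H := @measurable_fun_pair _ _ _ space (PD R) (PD R) _ _
    (measurable_coordinate i) (measurable_coordinate j).
  exact: (measurableT_comp measurable_K_lambda H).
rewrite /pooled_stat /T_hat; apply: measurable_funM => //.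
do 4! apply: measurable_sum_cond => ?.
rewrite /h_lambda /=.
by do !apply: measurable_funB => //; apply: measurable_funD.
Qed.

(** The decision of the test without the infimum, as a function of the pooled sample. The observed
    statistic enters as the one of the identity permutation, at index [ord_max]. *)
Definition rejects (g : 'I_B -> 'S_(n + m)) (u : 'I_(n + m) -> diagram R) :
    bool :=
  1 - alpha <= (B.+1%:R)^-1 * \sum_(b < B.+1)
    (pooled_stat (u \o (if unlift ord_max b is Some b' then g b' else 1%g : 'S_(n + m)))
     < pooled_stat u)%R%:R.

Lemma measurable_rejects (g : 'I_B -> 'S_(n + m)) :
  measurable ([set u | rejects g u] : set space).
Proof.
have mstat : measurable_fun setT (fun u : space => pooled_stat u).
  exact: measurable_pooled_stat id.
have -> : [set u | rejects g u] =
    (rejects g : space -> bool) @^-1` [set true] by [].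
rewrite -[X in measurable X]setTI.
apply: (_ : measurable_fun setT (rejects g : space -> bool)) => //.
apply: measurable_fun_ler => //; apply: measurable_funM => //.
apply: measurable_sum => b.
apply: (@measurableT_comp _ _ _ _ _ _ (fun c : bool => c%:R : R)) => //.
by apply: measurable_fun_ltr => //; exact: measurable_pooled_stat.
Qed.

Hypotheses (alpha_gt0 : 0 < alpha) (alpha_lt1 : alpha < 1).

Lemma Delta_rejects (X : 'I_n -> diagram R) (Y : 'I_m -> diagram R)
    (g : 'I_B -> 'S_(n + m)) :
  Delta w k1 k2 lam alpha X Y g = rejects g (pooled X Y) :> nat.
Proof.
rewrite /Delta /q_hat inf_quantile_lt//; congr nat_of_bool.
congr (_ <= _ * _); apply: eq_bigr => b _; rewrite T_hat_pooled /T_all.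
case: unliftP => [b' _|_]; first by [].
rewrite T_hat_pooled; congr ((pooled_stat _ < _)%R%:R).
by apply/funext => i /=; rewrite perm1.
Qed.

(** Products of permutations act from left to right, so relabelling [u] by [h] and then by [g b]
    amounts to relabelling it by [g b * h]; the bound on the group follows with v(h) the statistic
    of [u \o h]. *)
Lemma sum_rejects_le (u : 'I_(n + m) -> diagram R) :
  \sum_(g : {ffun 'I_B -> 'S_(n + m)}) \sum_(h : 'S_(n + m))
    (rejects g (u \o h))%:R <= alpha * (n + m)`!%:R ^+ B.+1.
Proof.
have := sum_group_rejections_le B alpha_gt0
  (fun h : 'S_(n + m) => pooled_stat (u \o h)).
rewrite card_Sn; apply: le_trans; rewrite le_eqVlt; apply/orP; left; apply/eqP.
apply: eq_bigr => g _; apply: eq_bigr => h _; congr (nat_of_bool _)%:R.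
congr (_ <= _ * _); apply: eq_bigr => b _.
congr ((pooled_stat _ < _)%R%:R); apply/funext => i /=.
by case: unlift => [b'|]; rewrite permE.
Qed.

End test_statistic.

(** * Law of the pooled sample under the null hypothesis *)

Section null_distribution.
Context {R : realType} {n m B : nat} {P : probability (PD R) R}.
Context d (T : measurableType d) (Pr : probability T R).
Variables (X : 'I_n -> {RV Pr >-> PD R}) (Y : 'I_m -> {RV Pr >-> PD R}).
Variable s : 'I_B -> T -> 'S_(n + m).
Hypothesis XYs_null : null_sampling P X Y s.

Local Notation space := (g_sigma_algebraType (boxes (PD R) 'I_(n + m))).

Definition pooled_sample (o : T) : space :=
  pooled (fun i => X i o) (fun j => Y j o).

Lemma measurable_pooled_sample (h : 'I_(n + m) -> 'I_(n + m)) :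
  measurable_fun setT (fun o => (pooled_sample o \o h : space)).
Proof.
apply: measurable_to_boxes => i /=; rewrite /pooled_sample /pooled.
by case: (fintype.split (h i)) => k; exact: measurable_funPT.
Qed.

Lemma pooled_sample_box (A : 'I_(n + m) -> set (PD R))
    (G : 'I_B -> set 'S_(n + m)) : (forall i, measurable (A i)) ->
  Pr ([set o | forall i, A i (pooled_sample o i)] `&`
      [set o | forall b, G b (s b o)]) =
  ((\prod_i P (A i)) * \prod_b Pr (s b @^-1` G b))%E.
Proof.
move=> mA; have [PX PY _ indep] := XYs_null.
(* Mutual independence is applied to the full index set, with one event for each diagram and each
   drawn permutation. *)
pose F (a : 'I_n + 'I_m + 'I_B) : set T :=
  match a with
  | inl (inl i) => X i @^-1` A (lshift m i)
  | inl (inr j) => Y j @^-1` A (rshift n j)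
  | inr b => s b @^-1` G b
  end.
have FE a : a \in [set: 'I_n + 'I_m + 'I_B]%SET -> sample_events X Y s a (F a).
  move=> _; case: a => [[i|j]|b] /=.
  - by exists (A (lshift m i)); [exact: mA|rewrite setTI].
  - by exists (A (rshift n j)); [exact: mA|rewrite setTI].
  - by exists (G b); rewrite ?setTI.
have := indep _ _ FE.
rewrite (eq_bigl xpredT); last by move=> a; rewrite finset.in_setT.
rewrite !big_sumType/= big_split_ord/=.
rewrite (eq_bigr (fun i => P (A (lshift m i)))); last first.
  by move=> i _; rewrite -(PX i _ (mA _)).
rewrite [X in (_ * X * _)%E](eq_bigr (fun i => P (A (rshift n i)))); last first.
  by move=> j _; rewrite -(PY j _ (mA _)).
move=> <-; congr (Pr _); apply/seteqP; split => o /=.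
  move=> [Ao Go] [[i|j]|b] _ /=.
  - by have := Ao (lshift m i); rewrite /pooled_sample /pooled (unsplitK (inl i)).
  - by have := Ao (rshift n j); rewrite /pooled_sample /pooled (unsplitK (inr j)).
  - exact: Go.
have inT a : [set` [set: 'I_n + 'I_m + 'I_B]%SET] a by rewrite /= finset.in_setT.
move=> Fo; split => [i|b]; last exact: Fo (inr b) (inT _).
rewrite -(splitK i) /pooled_sample /pooled unsplitK.
case: (fintype.split i) => k.
  exact: Fo (inl (inl k)) (inT _).
exact: Fo (inl (inr k)) (inT _).
Qed.

Lemma measurable_permutations (g : 'I_B -> 'S_(n + m)) :
  measurable [set o | forall b, s b o = g b].
Proof.
have [_ _ s_unif _] := XYs_null.
have -> : [set o | forall b, s b o = g b] =
    \bigcap_(b in setT) (s b @^-1` [set g b]).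
  by apply/seteqP; split => o /= so b; [move=> _; exact: so|exact: so b Logic.I].
apply: fin_bigcap_measurable => [|b _]; first exact: finite_finset.
by have [] := s_unif b (g b).
Qed.

(** Both sides are finite measures of [E], so boxes suffice. There independence gives a product of
    the [P (A i)], which [h] merely reorders, and each of the B draws equals its prescribed value
    with probability 1/(n + m)!. *)
Lemma pooled_sample_exchangeable (g : 'I_B -> 'S_(n + m)) (h : 'S_(n + m))
    (E : set space) : measurable E ->
  Pr ([set o | E (pooled_sample o)] `&` [set o | forall b, s b o = g b]) =
  (((n + m)`!%:R^-1 ^+ B)%:E * Pr [set o | E (pooled_sample o \o h)])%E.
Proof.
move=> mE; have [_ _ s_unif _] := XYs_null.
have c0 : 0 <= ((n + m)`!%:R^-1 ^+ B : R) by rewrite exprn_ge0// invr_ge0.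
pose U : T -> space := pooled_sample.
pose Uh o : space := pooled_sample o \o h.
have mU : measurable_fun setT U by exact: measurable_pooled_sample id.
have mUh : measurable_fun setT Uh by exact: measurable_pooled_sample h.
pose m1 : {measure set space -> \bar R} :=
  pushforward (mrestr Pr (measurable_permutations g)) U.
pose m2 : {measure set space -> \bar R} :=
  mscale (NngNum c0) (pushforward Pr Uh).
suff m12 : m1 mU E = m2 mUh E by exact: m12.
apply: (@box_measure_unique _ (PD R) 'I_(n + m) R (m1 mU) (m2 mUh)) => //.
  rewrite /m1/= /pushforward /mrestr; apply: le_lt_trans (ltry 1).
  by apply: probability_le1; rewrite preimage_setT setTI; exact: measurable_permutations.
move=> A mA; rewrite /m1 /m2 /mscale/= /mrestr /pushforward.
have -> : [set o | forall b, s b o = g b] =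
  [set o | forall b, [set g b] (s b o)] by [].
rewrite [LHS](pooled_sample_box (fun b => [set g b]) mA).
rewrite [X in (_ * X)%E](eq_bigr (fun=> (((n + m)`!%:R : R)^-1)%:E)); last first.
  by move=> b _; have [] := s_unif b (g b).
rewrite prodEFin prodr_const card_ord muleC; congr (_ * _)%E.
(* A box constraint on the sample relabelled by [h] is a box constraint on the sample itself, with
   indices moved by the inverse of [h]; the draws are left free. *)
rewrite [X in _ = Pr X](_ : _ =
    [set o | forall i, A ((h^-1)%g i) (pooled_sample o i)] `&`
    [set o | forall b : 'I_B, setT (s b o)]); last first.
  apply/seteqP; split => o /=.
    by move=> Ao; split => // i; have := Ao ((h^-1)%g i); rewrite /Uh/= permKV.
  by move=> [Ao _] i; have := Ao (h i); rewrite permK.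
rewrite (@pooled_sample_box (fun i => A ((h^-1)%g i)) (fun=> setT))//.
rewrite [X in (_ * X)%E]big1 ?mule1; last first.
  by move=> b _; rewrite preimage_setT probability_setT.
by rewrite (reindex_inj (@perm_inj _ (h^-1)%g)).
Qed.

End null_distribution.

Theorem proposition4p1 (R : realType) (F : fieldType)
  (M N : R) (M_gt0 : 0 < M) (N_gt0 : 0 < N)
  (w : R * R -> R) (w_weight : is_weight M w)
  (k1 k2 : R -> R) (k1_profile : is_kernel_profile k1)
  (k2_profile : is_kernel_profile k2)
  (n m : nat) (n_ge2 : (2 <= n)%N) (m_ge2 : (2 <= m)%N)
  (alpha : R) (alpha_gt0 : 0 < alpha) (alpha_lt1 : alpha < 1)
  (B : nat) (lam : R * R) (lam1_gt0 : 0 < lam.1) (lam2_gt0 : 0 < lam.2)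
  (P : probability (PD R) R) (P_class : in_class F M N w P)
  (d : measure_display) (T : measurableType d) (Pr : probability T R)
  (X : 'I_n -> {RV Pr >-> PD R}) (Y : 'I_m -> {RV Pr >-> PD R})
  (s : 'I_B -> T -> 'S_(n + m)) (XYs_sampling : null_sampling P X Y s) :
  (Pr [set o | Delta w k1 k2 lam alpha (fun i => X i o) (fun j => Y j o)
                 (fun b => s b o) = 1%N] <= alpha%:E)%E.
Proof.
have sw := weight_smooth w_weight.
have mk1 : measurable_fun setT k1.
  exact: set_mem (sub_Lfun_mfun (profile_L1 k1_profile)).
have mk2 : measurable_fun setT k2.
  exact: set_mem (sub_Lfun_mfun (profile_L1 k2_profile)).
pose rej (g : 'I_B -> 'S_(n + m)) (u : 'I_(n + m) -> diagram R) :=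
  rejects w k1 k2 lam alpha g u.
pose U := pooled_sample X Y.
have -> : [set o | Delta w k1 k2 lam alpha (fun i => X i o) (fun j => Y j o)
    (fun b => s b o) = 1%N] = [set o | rej (s ^~ o) (U o)].
  by apply/seteqP; split => o /=; rewrite Delta_rejects// -/(rej _ _);
    case: (rej _ _).
have mrej (g : 'I_B -> 'S_(n + m)) :=
  measurable_rejects lam sw mk1 mk2 alpha g.
have mperm := measurable_permutations XYs_sampling.
(* Rejection with frozen permutations [g] after relabelling the sample by [h]. *)
pose A (g : 'I_B -> 'S_(n + m)) (h : 'S_(n + m)) := [set o | rej g (U o \o h)].
have mA g h : measurable (A g h).
  rewrite -[X in measurable X]setTI.
  exact: (measurable_pooled_sample X Y h measurableT (mrej g)).
(* The rejection event is cut into disjoint pieces according to the value [g] of the draws. *)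
pose C (g : {ffun 'I_B -> 'S_(n + m)}) :=
  [set o | rej g (U o)] `&` [set o | forall b, s b o = g b].
have mC g : measurable (C g).
  apply: measurableI; last exact: mperm.
  rewrite -[X in measurable X]setTI.
  exact: (measurable_pooled_sample X Y id measurableT (mrej g)).
have CE o g : C g o -> g = [ffun b => s b o].
  by move=> [_ sg]; apply/ffunP => b; rewrite ffunE sg.
have ffunK o : [ffun b => s b o] = s ^~ o :> ('I_B -> 'S_(n + m)).
  by apply/funext => b; rewrite ffunE.
have E_bigcup : [set o | rej (s ^~ o) (U o)] = \bigcup_(g in setT) C g.
  apply/seteqP; split => o /= => [ro|[g _ Cgo]].
    exists [ffun b => s b o] => //.
    by split => [|b]; [rewrite /= ffunK|rewrite ffunE].
  by have := Cgo; rewrite (CE _ _ Cgo) => -[/=]; rewrite ffunK.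
have mE : measurable [set o | rej (s ^~ o) (U o)].
  rewrite E_bigcup; apply: fin_bigcup_measurable => [|g _]; last exact: mC.
  exact: finite_finset.
have PrE : (Pr [set o | rej (s ^~ o) (U o)] = \sum_g Pr (C g))%E.
  rewrite sum_measureE// -[in LHS](setIT [set o | _]) -integral_indic//.
  apply: eq_integral => o _; congr (_%:E).
  rewrite (bigD1 [ffun b => s b o])//= big1 ?addr0.
    rewrite !indicE; congr (nat_of_bool _)%:R; apply/idP/idP; rewrite !inE.
      by rewrite E_bigcup => -[g _ Cgo]; rewrite -(CE _ _ Cgo).
    by rewrite E_bigcup => Co; exists [ffun b => s b o].
  move=> g /eqP gs; rewrite indicE; case: (boolP (o \in C g)) => //.
  by rewrite inE => /CE.
pose K : R := (n + m)`!%:R.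
have K_gt0 : 0 < K by rewrite ltr0n fact_gt0.
(* The right-hand side does not involve [h]: this is what permits averaging over all
   relabellings. *)
have PrA (g : {ffun 'I_B -> 'S_(n + m)}) h : (Pr (A g h) = (K ^+ B)%:E * Pr (C g))%E.
  rewrite (pooled_sample_exchangeable XYs_sampling g h (mrej g)).
  by rewrite muleA -EFinM -exprMn divff ?expr1n ?mul1e// gt_eqF.
(* For each outcome the number of pairs (g, h) that reject is bounded by the combinatorial estimate,
   whatever the data. *)
have : (\sum_(p : {ffun 'I_B -> 'S_(n + m)} * 'S_(n + m)) Pr (A p.1 p.2) <=
    (alpha * K ^+ B.+1)%:E)%E.
  apply: sum_measure_le => // o.
  apply: le_trans (sum_rejects_le w k1 k2 lam B alpha_gt0 (U o)).
  rewrite pair_bigA/=; apply: ler_sum => -[g h] _ /=.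
  by rewrite indicE mem_setE.
(* The sum over [h] contributes a factor K and [PrA] a factor K^B, so K^(B+1) cancels on both
   sides. *)
rewrite -(pair_bigA _ (fun (g : {ffun 'I_B -> 'S_(n + m)}) h => Pr (A g h)))/=.
under eq_bigr do under eq_bigr do rewrite PrA.
under eq_bigr do rewrite sumr_const card_Sn.
rewrite sumrMnl -ge0_sume_distrr; last by move=> g _; exact: measure_ge0.
rewrite -PrE [X in (X <= _)%E](_ : _ = (K%:E * ((K ^+ B)%:E *
    Pr [set o | rej (s ^~ o) (U o)]))%E); last exact/esym/mule_natl.
rewrite muleA -EFinM -exprS mulrC EFinM lee_pmul2l//.
by rewrite lte_fin exprn_gt0.
Qed.
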